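(* Let $n\ge 2$ and let $D\subsetneq\mathbb{R}^n$ be a convex domain. Then for all $x,y\in D$, $$s_D(x,y)\le v_D(x,y)\le \pi\, s_D(x,y).$$
   Context: A domain is a nonempty open connected set. For three points $x,z,y\in\mathbb{R}^n$ with $z\ne x$, $z\neq y$, $\measuredangle(x,z,y)\in[0,\pi]$ denotes the angle at $z$ between the segments $[x,z]$ and $[y,z]$ (so it is $0$ if $x=y$). For a domain $G\subsetneq\mathbb{R}^n$ whose boundary $\partial G$ is not a proper subset of a line, the visual angle metric is $v_G(x,y)=\sup\{\measuredangle(x,z,y): z\in\partial G\}\in[0,\pi]$ for $x,y\in G$. (This condition on the boundary holds automatically for convex $G\subsetneq\mathbb{R}^n$, $n\ge2$.) For a domain $G\subsetneq\mathbb{R}^n$, the triangular ratio metric is $s_G(x,y)=\sup_{z\in\partial G}\frac{|x-y|}{|x-z|+|z-y|}\in[0,1]$ for $x,y\in G$. In both definitions $z$ ranges over the (finite) boundary points in $\mathbb{R}^n$. *)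

(* Defs.v *)
From HB Require Import structures.
From mathcomp Require Import all_boot all_order all_algebra.
From mathcomp Require Import all_classical all_reals all_analysis.
Set Implicit Arguments.
Unset Strict Implicit.
Unset Printing Implicit Defensive.
Import Order.TTheory GRing.Theory Num.Theory.
Import numFieldNormedType.Exports.
Local Open Scope classical_set_scope.
Local Open Scope ring_scope.

(* R^n is 'rV[R]_n. Its library topology is the product topology, hence the   *)
(* Euclidean one, but its library norm `|x| is the sup norm; the Euclidean    *)
(* norm is therefore eucl_norm below.                                         *)

Definition eucl_dot (R : realType) (n : nat) (u v : 'rV[R]_n) : R :=
  \sum_(i < n) u ord0 i * v ord0 i.

Definition eucl_norm (R : realType) (n : nat) (u : 'rV[R]_n) : R :=
  Num.sqrt (eucl_dot u u).

Definition eucl_dist (R : realType) (n : nat) (x y : 'rV[R]_n) : R :=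
  eucl_norm (x - y).

(* Meaningful for z != x and z != y only; the quotient is then in [-1, 1] by  *)
(* Cauchy-Schwarz, and equals 1 (angle 0) when x = y.                         *)
Definition angle (R : realType) (n : nat) (x z y : 'rV[R]_n) : R :=
  acos (eucl_dot (x - z) (y - z) / (eucl_dist x z * eucl_dist y z)).

Definition is_domain (T : topologicalType) (G : set T) : Prop :=
  [/\ G !=set0, open G & connected G].

Definition boundary (T : topologicalType) (G : set T) : set T :=
  closure G `\` interior G.

(* For a domain G other than the whole space and x, y in G, the two sets      *)
(* below are nonempty (G is not clopen) and bounded, and no denominator       *)
(* vanishes (an open G is disjoint from its boundary), so that the real sup   *)
(* is the actual supremum.                                                    *)

Definition visual_angle_metric (R : realType) (n : nat)
    (G : set 'rV[R]_n) (x y : 'rV[R]_n) : R :=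
  sup [set angle x z y | z in boundary G].

Definition triangular_ratio_metric (R : realType) (n : nat)
    (G : set 'rV[R]_n) (x y : 'rV[R]_n) : R :=
  sup [set eucl_dist x y / (eucl_dist x z + eucl_dist z y) | z in boundary G].

(* Main.v *)
Require Import Defs.
From HB Require Import structures.
From mathcomp Require Import all_boot all_order all_algebra.
From mathcomp Require Import all_classical all_reals all_analysis.
From mathcomp Require Import ring lra.
Import Order.TTheory GRing.Theory Num.Theory.
Import numFieldNormedType.Exports.
Local Open Scope classical_set_scope.
Local Open Scope ring_scope.

(* Upper bound: by the law of cosines the sine of half the angle at [z] is at
   most the ratio at [z], and [sin (t / 2) >= t / pi] on [0, pi].

   Lower bound: let [z] minimize [|x - z| + |z - y|] on the boundary.  The
   ellipsoid with foci [x], [y] through [z] has its interior in [D], so by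
   convexity its tangent hyperplane at [z] supports [D].  On this hyperplane
   there is a point [w] where the sine of the angle is at least the ratio at
   [z].  Since [w] is not in [D], the segment from [w] to the midpoint of [x] and
   [y] meets the boundary, and moving [w] towards the midpoint increases the
   angle. *)

(** * Euclidean scalar product and norm on row vectors *)

Section euclidean.
Context {R : realType} {n : nat}.
Implicit Types u v w : 'rV[R]_n.

Lemma eucl_dotC u v : eucl_dot u v = eucl_dot v u.
Proof. by apply: eq_bigr => i _; rewrite mulrC. Qed.

Lemma eucl_dotDl u v w : eucl_dot (u + v) w = eucl_dot u w + eucl_dot v w.
Proof.
by rewrite /eucl_dot -big_split; apply: eq_bigr => i _; rewrite mxE mulrDl.
Qed.

Lemma eucl_dotZl (k : R) u v : eucl_dot (k *: u) v = k * eucl_dot u v.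
Proof.
by rewrite /eucl_dot mulr_sumr; apply: eq_bigr => i _; rewrite mxE mulrA.
Qed.

Lemma eucl_dotNl u v : eucl_dot (- u) v = - eucl_dot u v.
Proof. by rewrite -scaleN1r eucl_dotZl mulN1r. Qed.

Lemma eucl_dotDr u v w : eucl_dot w (u + v) = eucl_dot w u + eucl_dot w v.
Proof. by rewrite eucl_dotC eucl_dotDl !(eucl_dotC w). Qed.

Lemma eucl_dotZr (k : R) u v : eucl_dot u (k *: v) = k * eucl_dot u v.
Proof. by rewrite eucl_dotC eucl_dotZl eucl_dotC. Qed.

Lemma eucl_dotNr u v : eucl_dot u (- v) = - eucl_dot u v.
Proof. by rewrite eucl_dotC eucl_dotNl eucl_dotC. Qed.

Lemma eucl_dot0l u : eucl_dot 0 u = 0.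
Proof. by rewrite -(scale0r u) eucl_dotZl mul0r. Qed.

Definition eucl_dotE :=
  (eucl_dotDl, eucl_dotDr, eucl_dotNl, eucl_dotNr, eucl_dotZl, eucl_dotZr).

Lemma eucl_dot_ge0 u : 0 <= eucl_dot u u.
Proof. by apply: sumr_ge0 => i _; rewrite -expr2 sqr_ge0. Qed.

Lemma coord_sqr_le_dot u i : u ord0 i ^+ 2 <= eucl_dot u u.
Proof.
rewrite /eucl_dot (bigD1 i)//= -expr2 lerDl.
by apply: sumr_ge0 => j _; rewrite -expr2 sqr_ge0.
Qed.

Lemma eucl_dot_gt0 u : u != 0 -> 0 < eucl_dot u u.
Proof.
move=> /eqP u0; rewrite lt_neqAle eucl_dot_ge0 andbT; apply/eqP => uu0.
apply: u0; apply/rowP => i; rewrite mxE; apply/eqP; rewrite -sqrf_eq0.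
rewrite -(@le_anti _ _ (u ord0 i ^+ 2) 0)// sqr_ge0 andbT uu0.
exact: coord_sqr_le_dot.
Qed.

Lemma eucl_norm_ge0 u : 0 <= eucl_norm u.
Proof. exact: sqrtr_ge0. Qed.

Lemma eucl_norm_gt0 u : u != 0 -> 0 < eucl_norm u.
Proof. by move=> u0; rewrite sqrtr_gt0 eucl_dot_gt0. Qed.

Lemma sqr_eucl_norm u : eucl_norm u ^+ 2 = eucl_dot u u.
Proof. by rewrite sqr_sqrtr// eucl_dot_ge0. Qed.

Lemma eucl_normN u : eucl_norm (- u) = eucl_norm u.
Proof. by rewrite /eucl_norm !eucl_dotE opprK. Qed.

Lemma eucl_distC u v : eucl_dist u v = eucl_dist v u.
Proof. by rewrite /eucl_dist -eucl_normN opprB. Qed.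

Lemma eucl_normZ (k : R) u : 0 <= k -> eucl_norm (k *: u) = k * eucl_norm u.
Proof.
move=> k0; rewrite /eucl_norm !eucl_dotE mulrA -expr2 sqrtrM ?sqr_ge0//.
by rewrite sqrtr_sqr ger0_norm.
Qed.

(** The squared norm of [(v.v) u - (u.v) v] equals [v.v] times the difference of the two sides, and
    [v.v] is positive unless [v = 0]. *)
Lemma cauchy_schwarz u v :
  eucl_dot u v ^+ 2 <= eucl_dot u u * eucl_dot v v.
Proof.
have [->|v0] := eqVneq v 0.
  by rewrite eucl_dotC !eucl_dot0l mulr0 expr0n.
have vv := eucl_dot_gt0 v v0.
have := eucl_dot_ge0 (eucl_dot v v *: u - eucl_dot u v *: v).
rewrite !eucl_dotE (eucl_dotC v u) => H.
have {}H : 0 <= eucl_dot v v * (eucl_dot u u * eucl_dot v v - eucl_dot u v ^+ 2).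
  by apply: le_trans H _; rewrite le_eqVlt; apply/orP; left; apply/eqP; ring.
by move: H; rewrite pmulr_rge0// subr_ge0.
Qed.

Lemma eucl_dot_le_norm u v : eucl_dot u v <= eucl_norm u * eucl_norm v.
Proof.
rewrite /eucl_norm -sqrtrM ?eucl_dot_ge0//; apply: le_trans (ler_norm _) _.
by rewrite -sqrtr_sqr ler_wsqrtr// cauchy_schwarz.
Qed.

Lemma eucl_normD u v : eucl_norm (u + v) <= eucl_norm u + eucl_norm v.
Proof.
rewrite -(@ler_pXn2r _ 2)// ?nnegrE ?addr_ge0 ?eucl_norm_ge0//.
rewrite sqr_eucl_norm sqrrD !sqr_eucl_norm !eucl_dotE (eucl_dotC v u).
have := eucl_dot_le_norm u v; lra.
Qed.

Lemma eucl_dist_triangle u v w :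
  eucl_dist u w <= eucl_dist u v + eucl_dist v w.
Proof. by rewrite /eucl_dist -[u - w](subrKA v) eucl_normD. Qed.

Lemma eucl_dist_gt0 u v : u != v -> 0 < eucl_dist u v.
Proof. by move=> uv; rewrite eucl_norm_gt0// subr_eq0. Qed.

Lemma cosine_itv u v : u != 0 -> v != 0 ->
  -1 <= eucl_dot u v / (eucl_norm u * eucl_norm v) <= 1.
Proof.
move=> u0 v0; have p := mulr_gt0 (eucl_norm_gt0 _ u0) (eucl_norm_gt0 _ v0).
rewrite ler_pdivlMr// ler_pdivrMr// mul1r mulN1r lerNl -eucl_dotNl.
by rewrite -[X in _ <= X * _]eucl_normN !eucl_dot_le_norm.
Qed.

(* The square root satisfies [sqrt (a^2 + s) <= a + s / (2 a)]. *)
Lemma eucl_norm_perturb u v (e : R) : u != 0 ->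
  eucl_norm (u - e *: v) <= eucl_norm u
    - e * (eucl_dot u v / eucl_norm u)
    + e ^+ 2 * (eucl_dot v v / (2 * eucl_norm u)).
Proof.
move=> u0; have a0 := eucl_norm_gt0 _ u0; set a := eucl_norm u in a0 *.
have := sqr_eucl_norm (u - e *: v); rewrite !eucl_dotE (eucl_dotC v u).
rewrite -sqr_eucl_norm -/a; set b := eucl_norm _ => bE.
rewrite -(ler_pM2l (mulr_gt0 (ltr0Sn R 1) a0)).
set V := eucl_dot v v in bE *; set W := eucl_dot u v in bE *.
have -> : 2 * a * (a - e * (W / a) + e ^+ 2 * (V / (2 * a))) = a ^+ 2 + b ^+ 2.
  by rewrite bE; field; lra.
by have := sqr_ge0 (a - b); lra.
Qed.

(** The first two coordinates suffice: rotate the projection of [u] to their plane by a right angle,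
    or take a basis vector when a coordinate of [u] vanishes. This is where the dimension hypothesis
    enters. *)
Lemma exists_unit_orthogonal u : (2 <= n)%N ->
  exists2 e, eucl_dot u e = 0 & eucl_dot e e = 1.
Proof.
move=> n2; suff [e ue e0] : exists2 e, eucl_dot u e = 0 & e != 0.
  exists ((eucl_norm e)^-1 *: e); first by rewrite !eucl_dotE ue mulr0.
  have p := eucl_norm_gt0 _ e0.
  by rewrite !eucl_dotE -sqr_eucl_norm expr2; field; rewrite gt_eqF.
have dE w i : eucl_dot w (delta_mx 0 i) = w 0 i.
  rewrite /eucl_dot (bigD1 i)//= !mxE !eqxx mulr1 big1 ?addr0// => j /negbTE ji.
  by rewrite mxE ji andbF mulr0.
pose i0 := Ordinal (ltnW n2); pose i1 := Ordinal n2.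
have d0 : (delta_mx 0 i0 : 'rV[R]_n) != 0.
  by apply/eqP => /rowP/(_ i0)/eqP; rewrite !mxE !eqxx oner_eq0.
have [u0|u0] := eqVneq (u 0 i1) 0.
  have [v0|v0] := eqVneq (u 0 i0) 0.
    by exists (delta_mx 0 i0) => //; rewrite dE.
  exists (delta_mx 0 i1); first by rewrite dE.
  by apply/eqP => /rowP/(_ i1)/eqP; rewrite !mxE !eqxx oner_eq0.
exists (u 0 i1 *: delta_mx 0 i0 - u 0 i0 *: delta_mx 0 i1).
  by rewrite !eucl_dotE !dE; ring.
apply/eqP => /rowP/(_ i0)/eqP; rewrite !mxE !eqxx/= mulr1 mulr0 subr0.
by apply/negP.
Qed.

End euclidean.

(** * Estimates for sine and arccosine *)

Section trigo.
Context {R : realType}.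
Implicit Types t c r : R.

Lemma sin_le_id t : 0 <= t -> sin t <= t.
Proof.
move=> t0.
have [|s _] := @MVT_segment R sin cos 0 t t0 (fun x _ => is_derive_sin x).
  by apply: continuous_subspaceT => x; exact: continuous_sin.
rewrite sin0 !subr0 => ->; rewrite ler_piMl//; exact: cos_le1.
Qed.

(** Concavity of the sine: if its graph were below the chord at [t], the mean value theorem would
    give a slope below [2 / pi] before [t] and one above it after [t], while the derivative [cos]
    decreases. *)
Lemma jordan_sin t : 0 <= t <= pi / 2 -> 2 / pi * t <= sin t.
Proof.
move=> /andP[t0 t1]; rewrite leNgt; apply/negP => lt.
have pi0 := pi_gt0 R.
have csin a b : {within `[a, b], continuous (@sin R)}.
  by apply: continuous_subspaceT => x; exact: continuous_sin.
have {}t0 : 0 < t.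
  rewrite lt_neqAle t0 andbT; apply/eqP => t0'; move: lt.
  by rewrite -t0' sin0 mulr0 ltxx.
have {}t1 : t < pi / 2.
  rewrite lt_neqAle t1 andbT; apply/eqP => t1'; move: lt; rewrite t1' sin_pihalf.
  by rewrite mulrA divfK ?gt_eqF// divff ?ltxx// gt_eqF.
have [a a0 ha] := MVT t0 (fun x _ => is_derive_sin x) (csin _ _).
have [b b0 hb] := MVT t1 (fun x _ => is_derive_sin x) (csin _ _).
move: a0 b0; rewrite !in_itv/= => /andP[a0 a1] /andP[b0 b1].
have : cos b < cos a.
  rewrite ltr_cos ?in_itv/=; lra.
rewrite sin_pihalf in hb; rewrite sin0 !subr0 in ha.
apply/negP; rewrite -leNgt.
have ca : cos a < 2 / pi.
  by rewrite -(ltr_pM2r t0) -ha.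
have cb : 2 / pi < cos b.
  rewrite -(@ltr_pM2r _ (pi / 2 - t)) ?subr_gt0// -hb mulrBr.
  have -> : 2 / pi * (pi / 2) = 1 :> R by field; lra.
  lra.
by apply: ltW; exact: lt_trans ca cb.
Qed.

(** If [c <= 0], then [acos c >= pi / 2 >= 1 >= r]. Otherwise [r <= sin (acos c) <= acos c]. *)
Lemma le_acos r c : 0 <= r <= 1 -> -1 <= c <= 1 ->
  c <= 0 \/ c ^+ 2 <= 1 - r ^+ 2 -> r <= acos c.
Proof.
move=> /andP[r0 r1] c1 [cle|cr].
  apply: (@le_trans _ _ (pi / 2)); first by have := pi_ge2 R; lra.
  rewrite leNgt; apply/negP => lt; have pi0 := pi_gt0 R.
  have a0 := acos_ge0 c1.
  move: (lt); rewrite -ltr_cos ?in_itv/= ?a0 ?acos_lepi//; last by lra.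
  by rewrite acosK// cos_pihalf ltNge cle.
apply: le_trans (sin_le_id _ (acos_ge0 c1)); rewrite sin_acos//.
by rewrite -[leLHS]ger0_norm// -sqrtr_sqr ler_wsqrtr//; lra.
Qed.

(** The hypothesis says [sin (acos c / 2) <= r], by the double angle formula; Jordan's inequality at
    [acos c / 2] concludes. *)
Lemma acos_le r c : 0 <= r -> -1 <= c <= 1 ->
  1 - c <= 2 * r ^+ 2 -> acos c <= pi * r.
Proof.
move=> r0 c1 cr; have pi0 := pi_gt0 R.
have a0 := acos_ge0 c1; have ap := acos_lepi c1.
have s0 : 0 <= sin (acos c / 2) by apply: sin_ge0_pi; lra.
have sr : sin (acos c / 2) <= r.
  rewrite -(@ler_pXn2r _ 2)//.
  have := cosD (acos c / 2) (acos c / 2); rewrite -splitr acosK//.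
  rewrite -!expr2 cos2sin2; lra.
have half : 0 <= acos c / 2 <= pi / 2 by lra.
have := le_trans (jordan_sin _ half) sr.
rewrite (_ : 2 / pi * (acos c / 2) = acos c / pi); last by field; lra.
by rewrite ler_pdivrMr// mulrC.
Qed.

End trigo.

(** * Comparison of the angle and the ratio at given points *)

Section angles.
Context {R : realType} {n : nat}.
Implicit Types x y z w : 'rV[R]_n.

Lemma triangular_ratio_itv x z y : x != z ->
  0 <= eucl_dist x y / (eucl_dist x z + eucl_dist z y) <= 1.
Proof.
move=> xz; have p : 0 < eucl_dist x z + eucl_dist z y.
  by rewrite ltr_wpDr ?eucl_norm_ge0 ?eucl_dist_gt0.
rewrite divr_ge0 ?eucl_norm_ge0 ?(ltW p)//= ler_pdivrMr// mul1r.
exact: eucl_dist_triangle.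
Qed.

Lemma angle_itv x z y : x != z -> y != z -> 0 <= angle x z y <= pi.
Proof.
rewrite -subr_eq0 -(subr_eq0 y) => xz yz.
by rewrite acos_ge0 ?acos_lepi// cosine_itv.
Qed.

Lemma angle_le_ratio x z y : x != z -> y != z ->
  angle x z y <= pi * (eucl_dist x y / (eucl_dist x z + eucl_dist z y)).
Proof.
move=> xz yz; have /andP[r0 _] := triangular_ratio_itv x z y xz.
have xz0 : x - z != 0 by rewrite subr_eq0.
have yz0 : y - z != 0 by rewrite subr_eq0.
apply: acos_le => //; first exact: cosine_itv.
have /andP[c1 _] := cosine_itv _ _ xz0 yz0.
rewrite expr_div_n sqr_eucl_norm (eucl_distC z y).
have -> : x - y = (x - z) - (y - z) by rewrite opprB addrA subrK.
have a0 := eucl_norm_gt0 _ xz0; have b0 := eucl_norm_gt0 _ yz0.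
rewrite /eucl_dist; move: (x - z) (y - z) c1 a0 b0 => p q c1 a0 b0.
rewrite !eucl_dotE (eucl_dotC q p) -!sqr_eucl_norm.
set A := eucl_norm p in c1 a0 *; set B := eucl_norm q in c1 b0 *.
set d := eucl_dot _ _ in c1 *; set c := d / _ in c1 *.
have -> : d = c * (A * B) by rewrite divfK// gt_eqF// mulr_gt0.
rewrite [leRHS]mulrA ler_pdivlMr ?exprn_gt0 ?addr_gt0//.
(* The goal is [(1 - c) * (A + B) ^+ 2 <= 2 * (A ^+ 2 + B ^+ 2 - 2 * c * A * B)], and its two sides
   differ by exactly this product. *)
have : 0 <= (1 + c) * (A - B) ^+ 2 by rewrite mulr_ge0 ?sqr_ge0//; lra.
lra.
Qed.

(** This is [le_acos] with denominators cleared, so that the later estimates are polynomial in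
    scalar products. *)
Lemma le_angle (r : R) x z y : 0 <= r <= 1 -> x != z -> y != z ->
  eucl_dot (x - z) (y - z) <= 0 \/
  eucl_dot (x - z) (y - z) ^+ 2 <=
    (1 - r ^+ 2) * (eucl_dot (x - z) (x - z) * eucl_dot (y - z) (y - z)) ->
  r <= angle x z y.
Proof.
move=> r01; rewrite -subr_eq0 -(subr_eq0 y) => xz yz H.
have a0 := eucl_norm_gt0 _ xz; have b0 := eucl_norm_gt0 _ yz.
apply: le_acos => //; first exact: cosine_itv.
case: H => H; [left|right].
  by rewrite pmulr_lle0// invr_gt0 mulr_gt0.
by rewrite expr_div_n ler_pdivrMr ?exprn_gt0 ?mulr_gt0// exprMn !sqr_eucl_norm.
Qed.

(* The angle grows when its apex moves towards the midpoint of [x] and [y]: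
   with [P, H, k] the scalar products of [w - m] and [h], the tangent is, up to
   a constant factor, [l / (l^2 P - H)]. *)
Lemma angle_condition_midpoint (r l : R) x y w :
  0 <= r <= 1 -> 0 <= l <= 1 ->
  let m := 2^-1 *: (x + y) in
  let z := m + l *: (w - m) in
  eucl_dot (x - w) (y - w) <= 0 \/
  eucl_dot (x - w) (y - w) ^+ 2 <=
    (1 - r ^+ 2) * (eucl_dot (x - w) (x - w) * eucl_dot (y - w) (y - w)) ->
  eucl_dot (x - z) (y - z) <= 0 \/
  eucl_dot (x - z) (y - z) ^+ 2 <=
    (1 - r ^+ 2) * (eucl_dot (x - z) (x - z) * eucl_dot (y - z) (y - z)).
Proof.
move=> /andP[r0 r1] /andP[l0 l1] m z.
pose h := 2^-1 *: (x - y); pose p := w - m.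
have -> : x - w = h - p by apply/rowP => i; rewrite !mxE; field.
have -> : y - w = - h - p by apply/rowP => i; rewrite !mxE; field.
have -> : x - z = h - l *: p by apply/rowP => i; rewrite !mxE; field.
have -> : y - z = - h - l *: p by apply/rowP => i; rewrite !mxE; field.
clearbody h p; rewrite !eucl_dotE (eucl_dotC p h).
have := cauchy_schwarz h p; have := eucl_dot_ge0 h; have := eucl_dot_ge0 p.
set P := eucl_dot p p; set H := eucl_dot h h; set k := eucl_dot h p.
move=> P0 H0 kHP.
have [le|lt] := leP (l ^+ 2 * P - H) 0; first by left; lra.
move=> W; right.
have lP : l ^+ 2 * P <= P by rewrite ler_piMl// expr_le1.
case: W => W; first by exfalso; lra.
(* In this form the right side contains the Gram determinant of [h] and [p], which scales by
   [l ^+ 2] when [p] becomes [l *: p]. It remains to see that [P - H] becomes at most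
   [l * (P - H)]. *)
have {}W : r ^+ 2 * (P - H) ^+ 2 <= (1 - r ^+ 2) * (4 * (H * P - k ^+ 2)) by lra.
have le : l ^+ 2 * P - H <= l * (P - H).
  rewrite -subr_ge0 (_ : _ - _ = (1 - l) * (l * P + H)); last by ring.
  by rewrite mulr_ge0 ?subr_ge0// addr_ge0// mulr_ge0.
have le2 : r ^+ 2 * (l ^+ 2 * P - H) ^+ 2 <= r ^+ 2 * (l ^+ 2 * (P - H) ^+ 2).
  rewrite ler_wpM2l ?sqr_ge0// -exprMn ler_pXn2r// nnegrE; lra.
have : l ^+ 2 * (r ^+ 2 * (P - H) ^+ 2) <=
       l ^+ 2 * ((1 - r ^+ 2) * (4 * (H * P - k ^+ 2))).
  by rewrite ler_wpM2l ?sqr_ge0.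
lra.
Qed.

(* [w] is chosen in the plane through [x] and [y] orthogonal to the hyperplane,
   on the sphere having [x] and the mirror image of [y] as antipodal points. *)
Lemma hyperplane_angle_condition_le (u : 'rV[R]_n) x y z : (2 <= n)%N ->
  eucl_dot u u = 1 ->
  0 < eucl_dot u (z - x) -> eucl_dot u (z - x) <= eucl_dot u (z - y) ->
  let r := eucl_dist x y / (eucl_dist x z + eucl_dist z y) in
  exists2 w, eucl_dot u (w - z) = 0 &
    eucl_dot (x - w) (y - w) ^+ 2 <=
    (1 - r ^+ 2) * (eucl_dot (x - w) (x - w) * eucl_dot (y - w) (y - w)).
Proof.
move=> n2 uu; set a := eucl_dot _ _ => a0; set b := eucl_dot _ _ => ab r.
(* [v] joins the feet of the perpendiculars from [x] and [y] to the hyperplane; [a] and [b] are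
   their lengths. *)
have [v uv yv] : exists2 v, eucl_dot u v = 0 & y = x + a *: u + v - b *: u.
  exists ((y + b *: u) - (x + a *: u)).
    by rewrite /a /b !eucl_dotE uu; ring.
  by apply/rowP => i; rewrite !mxE; ring.
have [d [e [d0 ue ee vE]]] : exists d e,
    [/\ 0 <= d, eucl_dot u e = 0, eucl_dot e e = 1 & v = d *: e].
  have [v0|v0] := eqVneq v 0.
    have [e ue ee] := exists_unit_orthogonal u n2.
    by exists 0, e; split; rewrite ?scale0r.
  have p := eucl_norm_gt0 _ v0.
  exists (eucl_norm v), ((eucl_norm v)^-1 *: v); split; first exact: ltW.
  - by rewrite !eucl_dotE uv mulr0.
  - by rewrite !eucl_dotE -sqr_eucl_norm expr2; field; rewrite gt_eqF.
  - by rewrite scalerA divff ?scale1r// gt_eqF.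
(* The nonnegative root of [t * (t - d) = a * b]. This equation says that the point at distance [t]
   along [e] from the foot of [x] sees [x] and the mirror image of [y] at a right angle. *)
pose t := (d + Num.sqrt (d ^+ 2 + 4 * (a * b))) / 2.
have ab0 : 0 < a * b by rewrite mulr_gt0//; lra.
have tE : t ^+ 2 = t * d + a * b.
  have : Num.sqrt (d ^+ 2 + 4 * (a * b)) ^+ 2 = d ^+ 2 + 4 * (a * b).
    by rewrite sqr_sqrtr// addr_ge0 ?sqr_ge0//; lra.
  rewrite /t; set q := Num.sqrt _ => qE.
  rewrite expr_div_n sqrrD qE; by field.
have t0 : 0 <= t by rewrite divr_ge0 ?addr_ge0 ?sqrtr_ge0.
have t2 : a * b <= t ^+ 2 by rewrite tE lerDr mulr_ge0.
have yE : y = x + a *: u + d *: e - b *: u.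
  by rewrite -vE.
exists (x + a *: u + t *: e).
  have -> : x + a *: u + t *: e - z = a *: u + t *: e - (z - x).
    by apply/rowP => i; rewrite !mxE; ring.
  by rewrite eucl_dotDr eucl_dotNr -/a eucl_dotDr !eucl_dotZr uu ue; ring.
set w := _ + t *: e.
have -> : x - w = - (a *: u + t *: e).
  by rewrite /w; apply/rowP => i; rewrite !mxE; ring.
have -> : y - w = (d - t) *: e - b *: u.
  by rewrite {1}yE /w; apply/rowP => i; rewrite !mxE; ring.
rewrite !eucl_dotE (eucl_dotC e u) ue uu ee.
have dxy : eucl_dist x y ^+ 2 = d ^+ 2 + (a - b) ^+ 2.
  rewrite sqr_eucl_norm [x - y](_ : _ = (b - a) *: u - d *: e).
    by rewrite !eucl_dotE (eucl_dotC e u) ue uu ee; ring.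
  by rewrite {1}yE; apply/rowP => i; rewrite !mxE; ring.
pose s := eucl_dist x z + eucl_dist z y.
(* Reflection principle: [z] is equidistant from [y] and its mirror image [y'], so [s] is at least
   the distance from [x] to [y']. *)
have sM : d ^+ 2 + (a + b) ^+ 2 <= s ^+ 2.
  pose y' := y + (2 * b) *: u.
  have -> : d ^+ 2 + (a + b) ^+ 2 = eucl_dist x y' ^+ 2.
    rewrite sqr_eucl_norm [x - y'](_ : _ = - (d *: e + (a + b) *: u)).
      by rewrite !eucl_dotE (eucl_dotC e u) ue uu ee; ring.
    by rewrite /y' {1}yE; apply/rowP => i; rewrite !mxE; ring.
  have zy : eucl_dist z y = eucl_dist z y'.
    congr Num.sqrt; rewrite [z - y'](_ : _ = (z - y) - (2 * b) *: u).
      have : eucl_dot u (z - y) = b by [].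
      move: (z - y) => q qb.
      by rewrite !eucl_dotE (eucl_dotC q u) qb uu; ring.
    by rewrite /y' opprD addrA.
  rewrite ler_pXn2r ?nnegrE ?addr_ge0 ?eucl_norm_ge0//.
  by rewrite /s zy eucl_dist_triangle.
have M0 : 0 < d ^+ 2 + (a + b) ^+ 2.
  by rewrite ltr_wpDl ?sqr_ge0// exprn_gt0//; lra.
have r2 : 4 * (a * b) <= (1 - r ^+ 2) * (d ^+ 2 + (a + b) ^+ 2).
  suff : r ^+ 2 * (d ^+ 2 + (a + b) ^+ 2) <= eucl_dist x y ^+ 2.
    by rewrite dxy; lra.
  have s0 : 0 < s ^+ 2 by exact: lt_le_trans sM.
  rewrite /r -/s expr_div_n -[leRHS](divfK (lt0r_neq0 s0)).
  by rewrite ler_wpM2l// divr_ge0 ?sqr_ge0// ltW.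
set Pw := (X in _ <= _ * (X * _)); set Qw := (X in _ <= _ * (_ * X)).
(* Because of the right angle at [w], the right triangles formed by [w], [x] and the foot of [x],
   and by [w], [y] and the foot of [y], are similar. *)
have QE : t ^+ 2 * Qw = b ^+ 2 * Pw.
  have tdt : t * (t - d) = a * b by rewrite mulrBr -expr2 tE; ring.
  have -> : t ^+ 2 * Qw = (t * (t - d)) ^+ 2 + b ^+ 2 * t ^+ 2 by rewrite /Qw; ring.
  by rewrite tdt /Pw; ring.
have t2_gt0 : 0 < t ^+ 2 by exact: lt_le_trans t2.
have PwE : Pw = a ^+ 2 + t ^+ 2 by rewrite /Pw; ring.
have PQ : a * b * (d ^+ 2 + (a + b) ^+ 2) <= Pw * Qw.
  rewrite -(ler_pM2l t2_gt0) -subr_ge0.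
  (* Pythagoras in the triangle with vertices [x], [w] and the mirror image of [y]. *)
  have -> : d ^+ 2 + (a + b) ^+ 2 = Pw + Qw.
    by rewrite /Pw /Qw; ring: tE.
  (* The sign of this product depends on [a <= b]. *)
  rewrite (_ : _ - _ = b * Pw * ((b - a) * (t ^+ 2 - a * b))).
    have b0 : 0 <= b by lra.
    by apply: mulr_ge0; apply: mulr_ge0; rewrite ?subr_ge0// PwE addr_ge0 ?sqr_ge0.
  have -> : t ^+ 2 * (Pw * Qw) - t ^+ 2 * (a * b * (Pw + Qw)) =
    Pw * (t ^+ 2 * Qw) - a * b * (t ^+ 2 * Pw + t ^+ 2 * Qw) by ring.
  by rewrite QE PwE; ring.
set X := 1 - r ^+ 2 in r2 *.
have X0 : 0 <= X by rewrite -(pmulr_lge0 _ M0); apply: le_trans r2; lra.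
apply: le_trans (ler_wpM2l X0 PQ).
have := ler_wpM2l (ltW ab0) r2.
set Y := X * _; rewrite (_ : X * _ = a * b * Y); last by rewrite /Y; ring.
(* By [tE] the scalar product of [x - w] and [y - w] is [2 * (a * b)], so its square is
   [a * b * (4 * (a * b))]. *)
apply: le_trans; rewrite le_eqVlt; apply/orP; left; apply/eqP.
by ring: tE.
Qed.

(** Reduces to a unit normal and to [x] being the point nearer to the hyperplane; the condition on
    [w] is symmetric in [x] and [y]. *)
Lemma hyperplane_angle_condition (u : 'rV[R]_n) x y z : (2 <= n)%N ->
  0 < eucl_dot u (z - x) -> 0 < eucl_dot u (z - y) ->
  let r := eucl_dist x y / (eucl_dist x z + eucl_dist z y) in
  exists2 w, eucl_dot u (w - z) = 0 &
    eucl_dot (x - w) (y - w) ^+ 2 <=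
    (1 - r ^+ 2) * (eucl_dot (x - w) (x - w) * eucl_dot (y - w) (y - w)).
Proof.
move=> n2 a0 b0; have u0 : u != 0.
  by apply/eqP => u0; move: a0; rewrite u0 eucl_dot0l ltxx.
have p := eucl_norm_gt0 _ u0.
pose v := (eucl_norm u)^-1 *: u.
have vv : eucl_dot v v = 1.
  by rewrite !eucl_dotE -sqr_eucl_norm expr2; field; rewrite gt_eqF.
have vE x' : eucl_dot v x' = (eucl_norm u)^-1 * eucl_dot u x'.
  by rewrite eucl_dotZl.
have ip : 0 < (eucl_norm u)^-1 by rewrite invr_gt0.
have v0 x' : eucl_dot v x' = 0 -> eucl_dot u x' = 0.
  by rewrite vE => /eqP; rewrite mulf_eq0 gt_eqF//= => /eqP.
have [ab|/ltW ba] := leP (eucl_dot u (z - x)) (eucl_dot u (z - y)).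
  have [||w /v0 uw hw] := hyperplane_angle_condition_le v x y z n2 vv.
  - by rewrite vE mulr_gt0.
  - by rewrite !vE ler_pM2l.
  by exists w.
have [||w /v0 uw hw] := hyperplane_angle_condition_le v y x z n2 vv.
- by rewrite vE mulr_gt0.
- by rewrite !vE ler_pM2l.
exists w => //; move: hw.
rewrite (eucl_distC y x) (eucl_distC y z) (eucl_distC z x).
rewrite (addrC (eucl_dist z y)) (eucl_dotC (y - w)).
by rewrite (mulrC (eucl_dot (y - w) _)).
Qed.

End angles.

(** * Boundaries of open sets *)

Lemma boundary_open_notin {T : topologicalType} (G : set T) z :
  open G -> boundary G z -> ~ G z.
Proof. by move=> /interior_id oG; rewrite /boundary oG => -[]. Qed.

Lemma open_boundary_neq {T : topologicalType} (G : set T) u z :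
  open G -> G u -> boundary G z -> u != z.
Proof.
move=> oG Gu /(boundary_open_notin G z oG) nGz.
by apply/eqP => uz; rewrite -uz in nGz.
Qed.

(** If [A] missed the boundary, the trace of [G] on [A] would equal that of [closure G], hence be
    open and closed in [A], and [G] would contain [q]. *)
Lemma connected_meets_boundary {T : topologicalType} (A G : set T) p q :
  connected A -> open G -> A p -> A q -> G p -> ~ G q ->
  exists2 z, A z & boundary G z.
Proof.
move=> cA oG Ap Aq Gp nGq; apply: contrapT => nb; apply: nGq.
suff AG : A `&` G = A by move: Aq; rewrite -AG => -[].
apply: cA; first by exists p.
  by exists G.
exists (closure G); first exact: closed_closure.
apply/seteqP; split=> z [Az Gz]; split => //; first exact: subset_closure.
apply: contrapT => nGz; apply: nb; exists z => //.
by rewrite /boundary (interior_id G).1.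
Qed.

(** * Minimal focal sums on the boundary and supporting hyperplanes *)

Section domains.
Context {R : realType} {n : nat}.
Implicit Types (x y z : 'rV[R]_n) (D : set 'rV[R]_n).

Lemma segment_meets_boundary D p q : open D -> D p -> ~ D q ->
  exists2 l : R, 0 <= l <= 1 & boundary D (p + l *: (q - p)).
Proof.
move=> oD Dp nDq.
have cs : continuous (fun l : R => p + l *: (q - p)).
  move=> l; apply: (@cvgD _ _ _ _ _ _ _ p); first exact: cvg_cst.
  exact: scalel_continuous.
have [|||_ [l l01 <-] bz] := connected_meets_boundary
  ((fun l : R => p + l *: (q - p)) @` `[0, 1]) D p q _ oD _ _ Dp nDq.
- apply: connected_continuous_connected; first exact: segment_connected.
  exact: continuous_subspaceT.
- by exists 0; rewrite /= ?in_itv/= ?lexx ?ler01// scale0r addr0.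
- by exists 1; rewrite /= ?in_itv/= ?lexx ?ler01// scale1r addrC subrK.
- by exists l; rewrite // -in_itv.
Qed.

Lemma eucl_dist_continuous x : continuous (eucl_dist x).
Proof.
have cd : continuous (fun z => eucl_dot (x - z) (x - z)).
  apply: (@continuous_big _ _ _ _ _ (@add_continuous R) _ _
    (fun i z => (x - z) ord0 i * (x - z) ord0 i)) => i _ z.
  have c : {for z, continuous (fun z => (x - z) ord0 i)}.
    have -> : (fun z => (x - z) ord0 i) = (fun z => x ord0 i - z ord0 i).
      by apply/funext => v; rewrite !mxE.
    by apply: continuousB; [exact: cst_continuous|exact: coord_continuous].
  exact: continuousM.
move=> z; apply: (@continuous_comp _ _ _ _ _ _ (cd z)).
exact: sqrt_continuous.
Qed.

(** The denominator of the triangular ratio; its sublevel sets are the ellipsoids with foci [x] and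
    [y]. *)
Definition focal_sum x y z : R := eucl_dist x z + eucl_dist z y.

Lemma focal_sum_continuous x y : continuous (focal_sum x y).
Proof.
move=> z; apply: continuousD; first exact: eucl_dist_continuous.
rewrite (_ : (fun v => eucl_dist v y) = eucl_dist y).
  exact: eucl_dist_continuous.
by apply/funext => v; rewrite eucl_distC.
Qed.

(** The boundary may be unbounded, so the minimum is taken on its part [K] where the sum is at most
    its value at a given boundary point. [K] is closed and lies in a coordinate box, hence is
    compact. *)
Lemma focal_sum_min D x y : boundary D !=set0 ->
  exists2 z, boundary D z &
    forall z', boundary D z' -> focal_sum x y z <= focal_sum x y z'.
Proof.
move=> [z1 bz1].
pose K := boundary D `&` [set z | focal_sum x y z <= focal_sum x y z1].
have Kz1 : K z1 by split; rewrite //= lexx.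
have [|||z zK zmin] := @EVT_min_rV R n (focal_sum x y) K.
- by exists z1.
- have cb : closed K.
    apply: closedI.
      apply: closedI; first exact: closed_closure.
      exact/open_closedC/open_interior.
    rewrite (_ : [set _ | _] = focal_sum x y @^-1` [set t | t <= focal_sum x y z1])//.
    apply: closed_comp; last exact: closed_le.
    by move=> z _; exact: focal_sum_continuous.
  pose C := focal_sum x y z1.
  apply: (@subclosed_compact _ _ [set v : 'rV[R]_n |
    forall i, v ord0 i \in `[x ord0 i - C, x ord0 i + C]]) => //.
    apply: (@rV_compact _ _ (fun i => `[x ord0 i - C, x ord0 i + C]%classic)) => i.
    exact: segment_compact.
  move=> z [_ /= zC] i; rewrite in_itv/= -ler_distlC.
  apply: le_trans zC; rewrite /focal_sum ler_wpDr ?eucl_norm_ge0//.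
  rewrite -sqrtr_sqr ler_wsqrtr//.
  by apply: le_trans (coord_sqr_le_dot (x - z) i); rewrite !mxE.
- exact/continuous_subspaceT/focal_sum_continuous.
exists z; first by move: zK; rewrite inE => -[].
move=> z' bz'; have [le|/ltW] := leP (focal_sum x y z') (focal_sum x y z1).
  by apply: zmin; apply/mem_set.
by apply: le_trans; apply: zmin; apply/mem_set.
Qed.

(** Otherwise the segment from [x] to [u] would meet the boundary. On this segment the focal sum is
    at most its value at [u], which is below the minimum. *)
Lemma focal_sublevel_subset D x y z : open D -> D x ->
  (forall z', boundary D z' -> focal_sum x y z <= focal_sum x y z') ->
  forall u, focal_sum x y u < focal_sum x y z -> D u.
Proof.
move=> oD Dx zmin u ltuz; apply: contrapT => nDu.
have [l /andP[l0 l1] /zmin] := segment_meets_boundary D x u oD Dx nDu.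
apply/negP; rewrite -ltNge; apply: le_lt_trans ltuz.
rewrite /focal_sum /eucl_dist.
have -> : x - (x + l *: (u - x)) = l *: (x - u).
  by apply/rowP => i; rewrite !mxE; ring.
have -> : x + l *: (u - x) - y = (1 - l) *: (x - y) + l *: (u - y).
  by apply/rowP => i; rewrite !mxE; ring.
have := eucl_normD ((1 - l) *: (x - y)) (l *: (u - y)).
rewrite !eucl_normZ ?subr_ge0//.
have := ler_wpM2l (_ : 0 <= 1 - l) (eucl_dist_triangle x u y).
rewrite subr_ge0 => /(_ l1); rewrite /eucl_dist; lra.
Qed.

Lemma convex_setD D x y (l : R) :
  convex_set (D : set (convex_lmodType 'rV[R]_n)) -> D x -> D y ->
  0 <= l -> l <= 1 -> D (l *: x + (1 - l) *: y).
Proof.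
move=> cD Dx Dy l0 l1.
by have := cD x y (Itv01 l0 l1); rewrite !inE => /(_ Dx Dy).
Qed.

Lemma open_shift D u v : open D -> D u -> exists2 e : R, 0 < e & D (u + e *: v).
Proof.
move=> oD Du.
have cs : continuous (fun l : R => u + l *: v).
  move=> l; apply: (@cvgD _ _ _ _ _ _ _ u); first exact: cvg_cst.
  exact: scalel_continuous.
have : \forall e \near (0 : R), D (u + e *: v).
  by apply: (cs 0); rewrite /= scale0r addr0; exact: open_nbhs_nbhs.
move=> /nbhs_ballP[e /= e0 De]; exists (e / 2); first by rewrite divr_gt0.
apply: De; rewrite /ball/= sub0r normrN ger0_norm; last by rewrite divr_ge0// ltW.
by rewrite ltr_pdivrMr// ltr_pMr// ltr1n.
Qed.

(* The tangent hyperplane of the ellipsoid [focal_sum x y < focal_sum x y z],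
   which is contained in [D], supports [D] at [z]: if [u] in [D] were strictly
   on the outer side, then [z] would lie between [u] and a point
   of the ellipsoid. *)
Lemma focal_sum_min_support D x y z :
  open D -> convex_set (D : set (convex_lmodType 'rV[R]_n)) -> D x -> D y ->
  boundary D z ->
  (forall z', boundary D z' -> focal_sum x y z <= focal_sum x y z') ->
  exists N, forall u, D u -> eucl_dot N (u - z) < 0.
Proof.
move=> oD cD Dx Dy bz zmin.
have nDz := boundary_open_notin D z oD bz.
have zx : z - x != 0 by rewrite subr_eq0 eq_sym (open_boundary_neq D).
have zy : z - y != 0 by rewrite subr_eq0 eq_sym (open_boundary_neq D).
have a0 := eucl_norm_gt0 _ zx; have b0 := eucl_norm_gt0 _ zy.
pose a := eucl_norm (z - x); pose b := eucl_norm (z - y).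
rewrite -/a -/b in a0 b0.
(* The gradient of [focal_sum x y] at [z]. *)
pose N := a^-1 *: (z - x) + b^-1 *: (z - y).
have outer u : D u -> eucl_dot N (u - z) <= 0.
  move=> Du; rewrite leNgt; apply/negP => Nu; apply: nDz.
  set v := u - z in Nu; set s := eucl_dot N v in Nu.
  have v0 : v != 0.
    by apply/eqP => v0; move: Nu; rewrite /s v0 eucl_dotC eucl_dot0l ltxx.
  have vv := eucl_dot_gt0 v v0.
  pose k := eucl_dot v v / (2 * a) + eucl_dot v v / (2 * b).
  have k0 : 0 < k by rewrite addr_gt0// divr_gt0// mulr_gt0.
  (* By [eucl_norm_perturb], moving from [z] by [- e *: v] lowers the focal sum by at least
     [e * s - e ^+ 2 * k]. This choice of [e] maximizes that bound, with value
     [s ^+ 2 / (4 * k)]. *)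
  pose e := s / (2 * k).
  have e0 : 0 < e by rewrite divr_gt0// mulr_gt0.
  have De : D (z - e *: v).
    apply: (focal_sublevel_subset D x y z oD Dx zmin).
    rewrite /focal_sum !(eucl_distC x) /eucl_dist -/a -/b.
    rewrite !(addrAC z (- (e *: v))).
    have := eucl_norm_perturb (z - x) v e zx.
    have := eucl_norm_perturb (z - y) v e zy.
    rewrite -/a -/b => h1 h2.
    have sE : s = eucl_dot (z - x) v / a + eucl_dot (z - y) v / b.
      by rewrite [LHS]eucl_dotDl !(eucl_dotZl _ (_ - _)); ring.
    have es : 0 < e * s - e ^+ 2 * k.
      rewrite (_ : _ - _ = s ^+ 2 / (4 * k)); last by rewrite /e; field; lra.
      by rewrite divr_gt0 ?exprn_gt0 ?mulr_gt0.
    have : e * s - e ^+ 2 * k = e * (eucl_dot (z - x) v / a) + e * (eucl_dot (z - y) v / b)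
        - e ^+ 2 * (eucl_dot v v / (2 * a)) - e ^+ 2 * (eucl_dot v v / (2 * b)).
      by rewrite sE /k; ring.
    lra.
  have e1 : 0 < 1 + e by lra.
  (* With these weights the convex combination is [z] itself. *)
  have := convex_setD D (z - e *: v) u (1 + e)^-1 cD De Du.
  rewrite invr_ge0 (ltW e1) invf_le1// lerDl (ltW e0) => /(_ isT isT).
  congr D; apply/rowP => i; rewrite /v !mxE; field; lra.
(* If the two unit vectors cancelled, [z] would lie on the segment from [x] to [y], hence in [D]. *)
have N0 : N != 0.
  apply/eqP => N0; apply: nDz.
  have ab : 0 < a + b by rewrite addr_gt0.
  have := convex_setD D x y (b / (a + b)) cD Dx Dy.
  rewrite divr_ge0 ?(ltW ab) ?(ltW b0)// ler_pdivrMr// mul1r lerDr (ltW a0).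
  move=> /(_ isT isT); congr D; apply/rowP => i; move/rowP/(_ i): N0.
  rewrite !mxE => N0.
  have {}N0 : b * (z 0 i - x 0 i) + a * (z 0 i - y 0 i) = 0.
    rewrite -[RHS](mulr0 (a * b)) -N0; field; lra.
  have -> : z 0 i = (b * x 0 i + a * y 0 i) / (a + b).
    by apply: (mulIf (lt0r_neq0 ab)); rewrite divfK ?lt0r_neq0//; lra.
  by field; lra.
(* Strictness comes from openness: the weak inequality also holds at [u + e *: N], where the scalar
   product is larger. *)
exists N => u Du; have [e e0 /outer] := open_shift D u N oD Du.
rewrite [u + _ - z]addrAC (eucl_dotDr (u - z)) eucl_dotZr.
have := mulr_gt0 e0 (eucl_dot_gt0 N N0); lra.
Qed.

Lemma convex_exists_angle_ge D x y z : (2 <= n)%N ->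
  open D -> convex_set (D : set (convex_lmodType 'rV[R]_n)) -> D x -> D y ->
  boundary D z ->
  (forall z', boundary D z' -> focal_sum x y z <= focal_sum x y z') ->
  exists2 w, boundary D w & eucl_dist x y / focal_sum x y z <= angle x w y.
Proof.
move=> n2 oD cD Dx Dy bz zmin.
have neq u w := @open_boundary_neq _ D u w oD.
have r01 := triangular_ratio_itv x z y (neq x z Dx bz).
have [N Nlt] := focal_sum_min_support D x y z oD cD Dx Dy bz zmin.
have [||w Nw hw] := hyperplane_angle_condition N x y z n2.
- by rewrite -opprB eucl_dotNr oppr_gt0 Nlt.
- by rewrite -opprB eucl_dotNr oppr_gt0 Nlt.
(* [w] is on the supporting hyperplane, which does not meet [D]. *)
have nDw : ~ D w by move=> /Nlt; rewrite Nw ltxx.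
have Dm : D (2^-1 *: (x + y)).
  have := convex_setD D x y 2^-1 cD Dx Dy; rewrite scalerDr.
  by rewrite (_ : 1 - 2^-1 = 2^-1); [apply; lra|lra].
have [l l01 bw] := segment_meets_boundary D _ w oD Dm nDw.
exists (2^-1 *: (x + y) + l *: (w - 2^-1 *: (x + y))) => //.
apply: le_angle => //; [exact: neq|exact: neq|].
by apply: angle_condition_midpoint => //; right.
Qed.

End domains.

Theorem theorem2p18 (R : realType) (n : nat) (hn : (2 <= n)%N)
  (D : set 'rV[R]_n)
  (D_domain : is_domain D)
  (D_proper : D <> setT)
  (D_convex : convex_set (D : set (convex_lmodType 'rV[R]_n))) :
  forall x y : 'rV[R]_n, D x -> D y ->
    triangular_ratio_metric D x y <= visual_angle_metric D x y /\
    visual_angle_metric D x y <= pi * triangular_ratio_metric D x y.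
Proof.
move=> x y Dx Dy; case: D_domain => _ oD _.
have neq u w := @open_boundary_neq _ D u w oD.
have [z1 bz1] : boundary D !=set0.
  have [q nDq] : exists q, ~ D q.
    apply: contrapT => nq; apply: D_proper; rewrite -subTset => q _.
    by apply: contrapT => nDq; apply: nq; exists q.
  by have [l _ bl] := segment_meets_boundary D x q oD Dx nDq; eexists; exact: bl.
split.
  have [z bz zmin] := focal_sum_min D x y (ex_intro _ z1 bz1).
  have [w bw lew] := convex_exists_angle_ge D x y z hn oD D_convex Dx Dy bz zmin.
  apply: ge_sup; first by exists (eucl_dist x y / focal_sum x y z1), z1.
  (* The ratio at [z'] is at most the ratio at the minimizer [z], hence at most the angle at [w].
     The bound [pi] is needed for this angle to be below the real [sup]. *)
  move=> _ [z' bz' <-]; apply: le_trans (le_trans lew _); last first.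
    apply: ub_le_sup; last by exists w.
    exists pi => _ [v bv <-].
    by have /andP[] := angle_itv x v y (neq _ _ Dx bv) (neq _ _ Dy bv).
  have pos v : boundary D v -> 0 < focal_sum x y v.
    by move=> bv; rewrite ltr_wpDr ?eucl_norm_ge0// eucl_dist_gt0// neq.
  by rewrite ler_wpM2l ?eucl_norm_ge0// lef_pV2 ?posrE ?pos// zmin.
apply: ge_sup; first by exists (angle x z1 y), z1.
move=> _ [z bz <-].
apply: le_trans (angle_le_ratio x z y (neq _ _ Dx bz) (neq _ _ Dy bz)) _.
rewrite ler_wpM2l ?pi_ge0//; apply: ub_le_sup; last by exists z.
exists 1 => _ [v bv <-].
by have /andP[] := triangular_ratio_itv x v y (neq _ _ Dx bv).
Qed.
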